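(* Let $R$ be an integral domain, let $F,G\in R[x]$ be polynomials of degrees $m$ and $n$ respectively with $m>n>0$, and let $(P_1^{(1)},\ldots,P_{l_1}^{(1)},\ldots,P_1^{(t)},\ldots,P_{l_t}^{(t)})$ be a complete recursive polynomial remainder sequence for $F$ and $G$. Put $j_0=m$ and $j_k=\deg P_{l_k}^{(k)}$ for $k=1,\ldots,t$. Assume that the matrices $U^{(k)}$ occurring in the construction of the reduced nested subresultant matrices of $F$ and $G$ are nonsingular. For $k=2,\ldots,t$ and $j=j_{k-1}-2,\ldots,0$, put $J_{k,j}=2j_{k-1}-2j-1$ and define $$\hat B_{k,j}=|U^{(k)}|^{J_{k,j}-1},\qquad \hat B_k=\hat B_{k,j_k}\ (k\ge 3),\qquad \hat B_1=\hat B_2=1,$$ $$\hat R_k=(\hat R_{k-1}\cdot\hat B_{k-1})^{J_{k,j_k}}\ (k\ge 3),\qquad \hat R_1=\hat R_2=1.$$ Then the $(k,j)$-th nested subresultant $\tilde S_{k,j}(F,G)$ and the $(k,j)$-th reduced nested subresultant $\hat S_{k,j}(F,G)$ of $F$ and $G$ satisfy $$\tilde S_{k,j}(F,G)=(\hat R_{k-1}\cdot\hat B_{k-1})^{J_{k,j}}\,\hat B_{k,j}\cdot\hat S_{k,j}(F,G).$$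
   Context: Throughout, $R$ is an integral domain with quotient field $K$, and $|M|$ denotes the determinant of a square matrix $M$ (the determinant of a $0\times0$ matrix is $1$). **PRS.** For polynomials $F,G\in R[x]$ of degrees $m>n$, a sequence $(P_1,\ldots,P_l)$ of nonzero polynomials is a polynomial remainder sequence (PRS) for $F$ and $G$ if $P_1=F$, $P_2=G$, and $\alpha_iP_{i-2}=q_{i-1}P_{i-1}+\beta_iP_i$ for $i=3,\ldots,l$, where $\alpha_i,\beta_i\in R$, the $q_{i-1}$ are polynomials, and $\deg P_{i-1}>\deg P_i$. **Recursive PRS.** A sequence $(P_1^{(1)},\ldots,P_{l_1}^{(1)},P_1^{(2)},\ldots,P_{l_2}^{(2)},\ldots,P_1^{(t)},\ldots,P_{l_t}^{(t)})$ of nonzero polynomials is a recursive PRS for $F$ and $G$ if: $P_1^{(1)}=F$, $P_2^{(1)}=G$; for $k=2,\ldots,t$, $P_1^{(k)}=P_{l_{k-1}}^{(k-1)}$ and $P_2^{(k)}=\frac{d}{dx}P_{l_{k-1}}^{(k-1)}$; and for every $k=1,\ldots,t$, $(P_1^{(k)},\ldots,P_{l_k}^{(k)})$ is a PRS for $P_1^{(k)}$ and $P_2^{(k)}$ with $P_{l_k}^{(k)}=\gamma_k\cdot\gcd(P_1^{(k)},P_2^{(k)})$ for some $\gamma_k\in R$. It is complete if $P_{l_t}^{(t)}$ is a constant. Put $j_0=m$, $j_k=\deg P_{l_k}^{(k)}$, and $n_i^{(k)}=\deg P_i^{(k)}$; thus $n_1^{(1)}=m$, $n_2^{(1)}=n$,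 and for $k\ge2$, $n_1^{(k)}=j_{k-1}$ and $n_2^{(k)}=j_{k-1}-1$. **Subresultant matrix.** Let $A=\sum_{i=0}^{p}a_ix^i$ and $B=\sum_{i=0}^{q}b_ix^i$ be polynomials regarded as having degrees $p>q\ge0$, and let $0\le j\le q$. $N^{(j)}(A,B)$ is the $(p+q-j)\times(p+q-2j)$ matrix whose column $c$ ($1\le c\le q-j$) has entry $a_{p-(r-c)}$ in row $r$, and whose column $q-j+c$ ($1\le c\le p-j$) has entry $b_{q-(r-c)}$ in row $r$, with entries of out-of-range index equal to $0$. The matrices below are defined for $k=1,\ldots,t$ and $j=j_{k-1}-2,\ldots,0$; the same formulas are used at the index $(k,j_k)$ whenever the recursion refers to it. **Nested subresultant matrix and nested subresultant.** Defined recursively by $\tilde N^{(1,j)}(F,G)=N^{(j)}(F,G)$ and, for $k>1$, $$\tilde N^{(k,j)}(F,G)=N^{(j)}\Big(\tilde S_{k-1,j_{k-1}}(F,G),\ \tfrac{d}{dx}\tilde S_{k-1,j_{k-1}}(F,G)\Big),$$ where the two polynomials are regarded as having degrees $j_{k-1}$ and $j_{k-1}-1$. For $\tau=j,\ldots,0$, $\tilde N_\tau^{(k,j)}$ is the square matrix formed by the top $n_1^{(k)}+n_2^{(k)}-2j-1$ rows and the $(n_1^{(k)}+n_2^{(k)}-j-\tau)$-th row of $\tilde N^{(k,j)}(F,G)$, and the $(k,j)$-th nested subresultant is $\tilde S_{k,j}(F,G)=|\tilde N_j^{(k,j)}|x^j+\cdots+|\tilde N_0^{(k,j)}|x^0$.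 **Reduced nested subresultant matrix** $\hat N^{(k,j)}=\hat N^{(k,j)}(F,G)$. For $k=1$, $\hat N^{(1,j)}=N^{(j)}(F,G)$. For $k>1$: let $\hat N_U^{(k-1,j_{k-1})}$ be $\hat N^{(k-1,j_{k-1})}$ with its bottom $j_{k-1}+1$ rows deleted, and $\hat N_L^{(k-1,j_{k-1})}$ the matrix of its bottom $j_{k-1}+1$ rows. For $\tau=j_{k-1},\ldots,0$ let $\hat N_\tau^{(k-1,j_{k-1})}$ be the square matrix with $\hat N_U^{(k-1,j_{k-1})}$ on top and the $(j_{k-1}-\tau+1)$-th row of $\hat N_L^{(k-1,j_{k-1})}$ as bottom row. Set $\hat A_\tau^{(k-1)}=|\hat N_\tau^{(k-1,j_{k-1})}|$, $\hat A^{(k-1)}(x)=\hat A_{j_{k-1}}^{(k-1)}x^{j_{k-1}}+\cdots+\hat A_0^{(k-1)}x^0$ (regarded as of degree $j_{k-1}$, its derivative as of degree $j_{k-1}-1$), and $$H=(H_{p,q})=N^{(j)}\Big(\hat A^{(k-1)}(x),\tfrac{d}{dx}\hat A^{(k-1)}(x)\Big),$$ a matrix with $I_{k,j}=n_1^{(k)}+n_2^{(k)}-j=(2j_{k-1}-2j-1)+j$ rows and $J_{k,j}=n_1^{(k)}+n_2^{(k)}-2j=2j_{k-1}-2j-1$ columns. Write $\hat N_U^{(k-1,j_{k-1})}=(U^{(k)}\mid\boldsymbol v^{(k)})$ with $U^{(k)}$ a square matrix and $\boldsymbol v^{(k)}$ a column vector. Since each $\hat N_\tau^{(k-1,j_{k-1})}$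 consists of $\hat N_U^{(k-1,j_{k-1})}$ and a bottom row, one expresses $$H_{p,q}=\begin{vmatrix}U^{(k)}&\boldsymbol v^{(k)}\\ \boldsymbol b_{p,q}^{(k)}&g_{p,q}^{(k)}\end{vmatrix}$$ with $\boldsymbol b_{p,q}^{(k)}$ a row vector and $g_{p,q}^{(k)}$ a number: if $H_{p,q}$ is the entry $c\,\hat A_\tau^{(k-1)}$ (with $c=1$ for a coefficient of $\hat A^{(k-1)}$ and $c=\tau$ for a coefficient of its derivative), then $(\boldsymbol b_{p,q}^{(k)}\mid g_{p,q}^{(k)})$ is $c$ times the bottom row of $\hat N_\tau^{(k-1,j_{k-1})}$; and $\boldsymbol b_{p,q}^{(k)}=\boldsymbol 0$, $g_{p,q}^{(k)}=0$ for $H_{p,q}=0$. Assume that $U^{(k)}$ is not singular. For $p=1,\ldots,I_{k,j}$ and $q=2,\ldots,J_{k,j}$, let the row vector $\boldsymbol x_{p,q}^{(k)}$ (over $K$) be the solution of $$\boldsymbol x_{p,q}^{(k)}U^{(k)}=\boldsymbol b_{p,1}^{(k)},$$ and define $h_{p,q}^{(k)}=\boldsymbol x_{p,q}^{(k)}\boldsymbol v^{(k)}$. Then $$\hat N^{(k,j)}(F,G)=\begin{pmatrix}U^{(k)}&\boldsymbol v^{(k)}&\boldsymbol v^{(k)}&\cdots&\boldsymbol v^{(k)}\\ \boldsymbol b_{1,1}^{(k)}&g_{1,1}^{(k)}&h_{1,2}^{(k)}&\cdots&h_{1,J_{k,j}}^{(k)}\\ \boldsymbol b_{2,1}^{(k)}&g_{2,1}^{(k)}&h_{2,2}^{(k)}&\cdots&h_{2,J_{k,j}}^{(k)}\\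 \vdots&\vdots&\vdots&&\vdots\\ \boldsymbol b_{I_{k,j},1}^{(k)}&g_{I_{k,j},1}^{(k)}&h_{I_{k,j},2}^{(k)}&\cdots&h_{I_{k,j},J_{k,j}}^{(k)}\end{pmatrix}.$$ **Reduced nested subresultant.** For $\tau=j,\ldots,0$, $\hat N_\tau^{(k,j)}$ is the square matrix formed by the top $m+n-2(k-1)-2j-1$ rows and the $(m+n-2(k-1)-j-\tau)$-th row of $\hat N^{(k,j)}(F,G)$ (which has $m+n-2(k-1)-2j$ columns), and the $(k,j)$-th reduced nested subresultant is $\hat S_{k,j}(F,G)=|\hat N_j^{(k,j)}|x^j+\cdots+|\hat N_0^{(k,j)}|x^0$.
   Formalization: Two formulas are corrected: x_{p,q} solves x_{p,q}U = b_{p,1} − b_{p,q} with h_{p,q} = g_{p,q} + x_{p,q}v (as printed, all reduced subresultants with k ≥ 2 vanish), and \hat B_2 = \hat B_{2,j_2} replaces \hat B_2 = 1, with which the identity fails at k = 3. *)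

(* Defs.v *)
From mathcomp Require Import all_boot all_order all_algebra.

Set Implicit Arguments.
Unset Strict Implicit.
Unset Printing Implicit Defensive.

Import GRing.Theory.

Local Open Scope ring_scope.

(* Sequences are indexed from 1: P i is the i-th member.  The quotients q may  *)
(* be taken in R[x], since clearing denominators only rescales alpha and beta. *)
Definition is_prs (R : idomainType) (A B : {poly R}) (l : nat)
    (P : nat -> {poly R}) : Prop :=
  [/\ (2 <= l)%N, P 1%N = A, P 2%N = B,
      forall i, (1 <= i <= l)%N -> P i != 0 &
      forall i, (3 <= i <= l)%N ->
        (exists (alpha beta : R) (q : {poly R}),
           alpha *: P (i - 2)%N = q * P (i - 1)%N + beta *: P i) /\
        (size (P i) < size (P (i - 1)%N))%N].

(* Over an integral domain, gcdp and %= are pseudo-operations: d is a greatest *)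
(* common divisor of A and B in K[x], K being the fraction field of R.         *)
Definition is_gcdp (R : idomainType) (d A B : {poly R}) : Prop :=
  d %= gcdp A B.

(* P k i is P_i^(k), for 1 <= k <= t and 1 <= i <= l k. *)
Definition is_recursive_prs (R : idomainType) (F G : {poly R}) (t : nat)
    (l : nat -> nat) (P : nat -> nat -> {poly R}) : Prop :=
  [/\ (1 <= t)%N, P 1%N 1%N = F, P 1%N 2%N = G,
      forall k, (2 <= k <= t)%N ->
        P k 1%N = P k.-1 (l k.-1) /\ P k 2%N = (P k.-1 (l k.-1))^`() &
      forall k, (1 <= k <= t)%N ->
        is_prs (P k 1%N) (P k 2%N) (l k) (P k) /\
        exists (gamma : R) (d : {poly R}),
          is_gcdp d (P k 1%N) (P k 2%N) /\ P k (l k) = gamma *: d].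

Definition is_complete_recursive_prs (R : idomainType) (F G : {poly R})
    (t : nat) (l : nat -> nat) (P : nat -> nat -> {poly R}) : Prop :=
  is_recursive_prs F G t l P /\ (size (P t (l t)) <= 1)%N.

(* The degrees j_k; size is degree + 1. *)
Definition last_degree (R : idomainType) (m : nat) (l : nat -> nat)
    (P : nat -> nat -> {poly R}) (k : nat) : nat :=
  if k is 0 then m else (size (P k (l k))).-1.

(* Entry (r, c), counted from 0, of N^(j)(A, B), where A and B, regarded as    *)
(* having degrees p and q, are given by coefficient functions a and b.  The    *)
(* coefficients may lie in any V: below, V is the ring of coefficients, or a   *)
(* space of row vectors that stand for coefficients.                           *)
Definition subres_entry (V : nmodType) (p q j : nat) (a b : nat -> V)
    (r c : nat) : V :=
  if (c < q - j)%N then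
    if (c <= r <= c + p)%N then a (p - (r - c))%N else 0
  else let c' := (c - (q - j))%N in
    if (c' <= r <= c' + q)%N then b (q - (r - c'))%N else 0.

(* All matrices from which subresultants are extracted have u + (j + 1) rows   *)
(* and u + 1 columns, and are typed accordingly.  For N^(j)(A, B), with        *)
(* j <= q < p, one has u = p + q - 2j - 1.                                     *)
Definition subres_mx (R : nzRingType) (p q j : nat) (A B : {poly R}) :
    'M[R]_((p + q - j.*2).-1 + j.+1, (p + q - j.*2).-1 + 1) :=
  \matrix_(r, c) subres_entry p q j (fun i => A`_i) (fun i => B`_i) r c.

(* The top u rows and row i, counted from 0, of the bottom j + 1 rows. *)
Definition minor_mx (R : Type) (u j : nat) (M : 'M[R]_(u + j.+1, u + 1))
    (i : 'I_j.+1) : 'M[R]_(u + 1, u + 1) :=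
  col_mx (usubmx M) (row i (dsubmx M)).

(* The coefficient of x^tau comes from row j - tau of the bottom rows. *)
Definition subres_poly (R : comNzRingType) (u j : nat)
    (M : 'M[R]_(u + j.+1, u + 1)) : {poly R} :=
  \poly_(tau < j.+1) \det (minor_mx M (inord (j - tau))).

(* tilde S_{i+1,j}; the function d gives the degrees j_k. *)
Fixpoint nested_subres_rec (R : comNzRingType) (m n : nat) (d : nat -> nat)
    (F G : {poly R}) (i j : nat) : {poly R} :=
  match i with
  | 0 => subres_poly (subres_mx m n j F G)
  | i'.+1 =>
      let T := nested_subres_rec m n d F G i' (d i) in
      subres_poly (subres_mx (d i) (d i).-1 j T T^`())
  end.

(* The nested subresultant tilde S_{k,j}, for k >= 1. *)
Definition nested_subres (R : comNzRingType) (m n : nat) (d : nat -> nat)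
    (F G : {poly R}) (k j : nat) : {poly R} :=
  nested_subres_rec m n d F G k.-1 j.

(* With M = hat N^(k-1,d) and d = j_{k-1}, write M_U = (U | v). *)
Definition Umx (K : Type) (u d : nat) (M : 'M[K]_(u + d.+1, u + 1)) : 'M[K]_u :=
  lsubmx (usubmx M).

Definition vcol (K : Type) (u d : nat) (M : 'M[K]_(u + d.+1, u + 1)) : 'cV[K]_u :=
  rsubmx (usubmx M).

(* The row vector (b_{p,q} | g_{p,q}), with p and q counted from 0.  The       *)
(* coefficient hat A_tau is represented by the bottom row of hat N_tau, and    *)
(* the coefficient (i + 1) hat A_{i+1} of x^i in the derivative by i + 1 times *)
(* the bottom row of hat N_{i+1}; positions outside the range of coefficients  *)
(* get the zero row.                                                           *)
Definition bg_row (K : fieldType) (u d : nat) (M : 'M[K]_(u + d.+1, u + 1))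
    (j p q : nat) : 'rV[K]_(u + 1) :=
  let bottom tau := row (inord (d - tau)) (dsubmx M) in
  subres_entry d d.-1 j bottom (fun i => bottom i.+1 *+ i.+1) p q.

Definition bvec (K : fieldType) (u d : nat) (M : 'M[K]_(u + d.+1, u + 1))
    (j p q : nat) : 'rV[K]_u := lsubmx (bg_row M j p q).

Definition gval (K : fieldType) (u d : nat) (M : 'M[K]_(u + d.+1, u + 1))
    (j p q : nat) : K := rsubmx (bg_row M j p q) 0 0.

(* The solution x of x U = b_{p,1} - b_{p,q}; column 1 has index 0 here. *)
Definition xvec (K : fieldType) (u d : nat) (M : 'M[K]_(u + d.+1, u + 1))
    (j p q : nat) : 'rV[K]_u :=
  (bvec M j p 0 - bvec M j p q) *m invmx (Umx M).

(* Adding the rows of (U | v), weighted by x, to (b_{p,q} | g_{p,q}) gives     *)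
(*   | U v ; b_{p,q} g_{p,q} | = | U v ; b_{p,1} h_{p,q} |,                    *)
(* which lets all columns of the reduced matrix share the block b_{p,1}.       *)
(* Taking x U = b_{p,1} and h = x v instead would make the right-hand side     *)
(* vanish, and with it hat S_{k,j} for all k > 1 and j <= j_{k-1} - 2.         *)
Definition hval (K : fieldType) (u d : nat) (M : 'M[K]_(u + d.+1, u + 1))
    (j p q : nat) : K :=
  gval M j p q + (xvec M j p q *m vcol M) 0 0.

(* hat N^(k,j) from M = hat N^(k-1,d), where d = j_{k-1} > j.  With            *)
(* e = d - 1 - j, the bottom block has I_{k,j} = 2 e + (j + 1) rows and its    *)
(* right part has J_{k,j} = 2 e + 1 columns.                                   *)
Definition reduced_step (K : fieldType) (u d : nat)
    (M : 'M[K]_(u + d.+1, u + 1)) (j : nat) :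
    'M[K]_(u + (d.-1 - j).*2 + j.+1, u + (d.-1 - j).*2 + 1) :=
  castmx (addnA _ _ _, addnA _ _ _)
    (block_mx
       (Umx M)
       (\matrix_(i < u, q < (d.-1 - j).*2 + 1) vcol M i 0)
       (\matrix_(p < (d.-1 - j).*2 + j.+1) bvec M j p 0)
       (\matrix_(p < (d.-1 - j).*2 + j.+1, q < (d.-1 - j).*2 + 1)
          if q == 0%N :> nat then gval M j p 0 else hval M j p q)).

(* The index u of hat N^(i+1,j), equal to m + n - 2 i - 2 j - 1. *)
Fixpoint reduced_size (m n : nat) (d : nat -> nat) (i j : nat) : nat :=
  match i with
  | 0 => (m + n - j.*2).-1
  | i'.+1 => (reduced_size m n d i' (d i) + ((d i).-1 - j).*2)%N
  end.

(* hat N^(i+1,j). *)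
Fixpoint reduced_nested_mx_rec (K : fieldType) (m n : nat) (d : nat -> nat)
    (F G : {poly K}) (i j : nat) :
    'M[K]_(reduced_size m n d i j + j.+1, reduced_size m n d i j + 1) :=
  match i with
  | 0 => subres_mx m n j F G
  | i'.+1 => reduced_step (reduced_nested_mx_rec m n d F G i' (d i'.+1)) j
  end.

(* hat N^(k,j), for k >= 1. *)
Definition reduced_nested_mx (K : fieldType) (m n : nat) (d : nat -> nat)
    (F G : {poly K}) (k j : nat) :
    'M[K]_(reduced_size m n d k.-1 j + j.+1, reduced_size m n d k.-1 j + 1) :=
  reduced_nested_mx_rec m n d F G k.-1 j.

Definition reduced_nested_subres (K : fieldType) (m n : nat) (d : nat -> nat)
    (F G : {poly K}) (k j : nat) : {poly K} :=
  subres_poly (reduced_nested_mx m n d F G k j).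

(* U^(k), for k >= 2. *)
Definition nestedU (K : fieldType) (m n : nat) (d : nat -> nat)
    (F G : {poly K}) (k : nat) : 'M[K]_(reduced_size m n d k.-2 (d k.-1)) :=
  Umx (reduced_nested_mx m n d F G k.-1 (d k.-1)).

Definition Jnum (d : nat -> nat) (k j : nat) : nat :=
  ((d k.-1).*2 - j.*2 - 1)%N.

Definition Bhat_at (K : fieldType) (m n : nat) (d : nat -> nat)
    (F G : {poly K}) (k j : nat) : K :=
  \det (nestedU m n d F G k) ^+ (Jnum d k j).-1.

(* The value at k = 2 is |U^(2)|^(J_{2,j_2} - 1), the ratio of                 *)
(* tilde S_{2,j_2} to hat S_{2,j_2}; it is not 1 in general.                   *)
Definition Bhat (K : fieldType) (m n : nat) (d : nat -> nat)
    (F G : {poly K}) (k : nat) : K :=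
  if (k <= 1)%N then 1 else Bhat_at m n d F G k (d k).

Fixpoint Rhat (K : fieldType) (m n : nat) (d : nat -> nat)
    (F G : {poly K}) (k : nat) : K :=
  match k with
  | 0 => 1
  | k'.+1 =>
      if (k <= 2)%N then 1
      else (Rhat m n d F G k' * Bhat m n d F G k') ^+ Jnum d k (d k)
  end.

(* Main.v *)
Require Import Defs.
From mathcomp Require Import all_boot all_order all_algebra.

Set Implicit Arguments.
Unset Strict Implicit.
Unset Printing Implicit Defensive.

Import GRing.Theory.

Local Open Scope ring_scope.

(** The theorem is one computation with Schur complements, carried through an
    induction on k.

    Let M be the matrix hat N^(k-1,d) with d = j_{k-1}, let (U | v) be its top
    part, and let A = hat S_{k-1,d}.  Each coefficient of A is the determinant
    of (U | v) bordered by a row w = (b | g), hence equals |U| f(w), where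
    f(w) = g - b U^-1 v is linear in w ([det_minor_mx]).  By linearity every
    entry of H = N^(j)(A, A') has the form |U| f(w), where w is the row
    (b_{p,q} | g_{p,q}); so H = |U| S, where S is the matrix of the scalars
    f(b_{p,q} | g_{p,q}) ([schur_mx], [subres_poly_schur_mx]).

    On the other side, h_{p,q} is defined so that the Schur complement of the
    block U in hat N^(k,j) is the same matrix S: the correction x v turns
    h_{p,q} - b_{p,1} U^-1 v into g_{p,q} - b_{p,q} U^-1 v.  Therefore a minor
    of hat N^(k,j) is |U| times a minor of S ([subres_poly_reduced_step]), while
    a minor of H is |U|^J times it, with J = J_{k,j}.  The subresultant of A and
    A' is thus |U|^(J-1) = hat B_{k,j} times hat S_{k,j}.

    Finally, subresultants of c A and (c A)' are c^J times those of A and A'.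
    If tilde S_{k-1,d} = c hat S_{k-1,d}, this gives
    tilde S_{k,j} = c^J hat B_{k,j} hat S_{k,j} ([nested_subres_step]); for
    j = j_k this is the recursion that defines the product of hat R_k and
    hat B_k ([nested_subres_reduced]).  The exponent J counts the columns of H
    only when j < d, which is why the degrees j_k must decrease
    ([last_degree_decreasing]). *)

(** * Schur complements *)

Lemma det_schur (K : fieldType) (u v : nat) (U : 'M[K]_u) (A : 'M_(u, v))
    (B : 'M_(v, u)) (D : 'M_v) :
  U \in unitmx ->
  \det (block_mx U A B D) = \det U * \det (D - B *m invmx U *m A).
Proof.
move=> Uu.
have -> : block_mx U A B D =
    block_mx 1%:M 0 (B *m invmx U) 1%:M *m
    block_mx U A 0 (D - B *m invmx U *m A).
  by rewrite mulmx_block !mul1mx !mul0mx !addr0 mulmxKV // addrC subrK.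
by rewrite det_mulmx det_lblock det_ublock !det1 !mul1r.
Qed.

(** * Subresultants under ring morphisms and scaling *)

(** The entries of a subresultant matrix are zeros or single coefficients, so
    any map that sends 0 to 0 passes through.  Coefficient functions
    are compared only up to the nominal degrees, because beyond them the row
    vectors that represent coefficients are arbitrary. *)
Lemma subres_entry_map (V W : nmodType) (f : V -> W) (p q j : nat)
    (a b : nat -> V) (a' b' : nat -> W) (r c : nat) :
  f 0 = 0 ->
  (forall i, (i <= p)%N -> a' i = f (a i)) ->
  (forall i, (i <= q)%N -> b' i = f (b i)) ->
  subres_entry p q j a' b' r c = f (subres_entry p q j a b r c).
Proof.
move=> f0 fa fb; rewrite /subres_entry.
by case: ifP => _; case: ifP => _; rewrite ?f0 ?fa ?fb ?leq_subr.
Qed.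

Lemma minor_mx_map (R S : Type) (f : R -> S) (u j : nat)
    (M : 'M[R]_(u + j.+1, u + 1)) i :
  minor_mx (map_mx f M) i = map_mx f (minor_mx M i).
Proof.
by rewrite /minor_mx map_col_mx map_usubmx map_row map_dsubmx.
Qed.

Lemma map_subres_poly (R S : comNzRingType) (f : {rmorphism R -> S})
    (u j : nat) (M : 'M[R]_(u + j.+1, u + 1)) :
  map_poly f (subres_poly M) = subres_poly (map_mx f M).
Proof.
apply/polyP=> i; rewrite coef_map !coef_poly.
case: ifP => _; last exact: rmorph0.
by rewrite minor_mx_map det_map_mx.
Qed.

Lemma map_subres_mx (R S : comNzRingType) (f : {rmorphism R -> S})
    (p q j : nat) (A B : {poly R}) :
  map_mx f (subres_mx p q j A B) =
  subres_mx p q j (map_poly f A) (map_poly f B).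
Proof.
apply/matrixP=> r c; rewrite !mxE; apply/esym/subres_entry_map => [|i _|i _];
  by rewrite ?rmorph0 ?coef_map.
Qed.

(** Nested subresultants live over R and reduced ones over its fraction field;
    this moves the former to the field, where the comparison takes place. *)
Lemma map_nested_subres (R S : comNzRingType) (f : {rmorphism R -> S})
    (m n : nat) (d : nat -> nat) (F G : {poly R}) (k j : nat) :
  map_poly f (nested_subres m n d F G k j) =
  nested_subres m n d (map_poly f F) (map_poly f G) k j.
Proof.
rewrite /nested_subres; elim: k.-1 j => [|i IH] j /=.
  by rewrite map_subres_poly map_subres_mx.
by rewrite map_subres_poly map_subres_mx -deriv_map IH.
Qed.

Lemma subres_polyZ (R : comNzRingType) (u j : nat) (c : R)
    (M : 'M[R]_(u + j.+1, u + 1)) :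
  subres_poly (c *: M) = c ^+ (u + 1) *: subres_poly M.
Proof.
apply/polyP=> i; rewrite coefZ !coef_poly.
case: ifP => _; last by rewrite mulr0.
by rewrite -detZ /minor_mx !linearZ /= scale_col_mx.
Qed.

Lemma subres_mxZ (R : comNzRingType) (p q j : nat) (c : R) (A B : {poly R}) :
  subres_mx p q j (c *: A) (c *: B) = c *: subres_mx p q j A B.
Proof.
apply/matrixP=> r s; rewrite !mxE.
apply: (@subres_entry_map _ _ ( *%R c)) => [|i _|i _]; rewrite ?mulr0 //;
  by rewrite coefZ.
Qed.

(** * Bordered determinants as a linear form on the last row *)

(** For nonsingular U, |U| times this form is the determinant of (U | v) bordered
    below by the row w. *)
Definition schur_form (K : fieldType) (u d : nat)
    (M : 'M[K]_(u + d.+1, u + 1)) (w : 'rV[K]_(u + 1)) : K :=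
  (rsubmx w - lsubmx w *m invmx (Umx M) *m vcol M) 0 0.

Lemma schur_formD (K : fieldType) (u d : nat) (M : 'M[K]_(u + d.+1, u + 1)) :
  {morph schur_form M : w z / w + z}.
Proof.
move=> w z; rewrite /schur_form linearD /= [lsubmx _]linearD /= !mulmxDl.
by rewrite opprD addrACA mxE.
Qed.

Lemma schur_form0 (K : fieldType) (u d : nat) (M : 'M[K]_(u + d.+1, u + 1)) :
  schur_form M 0 = 0.
Proof. by apply: (addIr (schur_form M 0)); rewrite -schur_formD !add0r. Qed.

Lemma schur_formMn (K : fieldType) (u d : nat) (M : 'M[K]_(u + d.+1, u + 1))
    (w : 'rV[K]_(u + 1)) (i : nat) :
  schur_form M (w *+ i) = schur_form M w *+ i.
Proof.
elim: i => [|i IH]; first by rewrite !mulr0n schur_form0.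
by rewrite !mulrS schur_formD IH.
Qed.

Lemma det_minor_mx (K : fieldType) (u d : nat) (M : 'M[K]_(u + d.+1, u + 1)) i :
  Umx M \in unitmx ->
  \det (minor_mx M i) = \det (Umx M) * schur_form M (row i (dsubmx M)).
Proof.
move=> Uu; rewrite /minor_mx -[usubmx M]hsubmxK -[row i _]hsubmxK.
rewrite -/(Umx M) -/(vcol M).
by rewrite -block_mxEv det_schur // hsubmxK det_mx11.
Qed.

(** The matrix that links both constructions: |U| times it is the subresultant
    matrix of hat A and its derivative, and it is also the Schur complement of
    the block U in the reduced matrix. *)
Definition schur_mx (K : fieldType) (u d : nat)
    (M : 'M[K]_(u + d.+1, u + 1)) (j : nat) :
    'M[K]_((d.-1 - j).*2 + j.+1, (d.-1 - j).*2 + 1) :=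
  \matrix_(p, q) schur_form M (bg_row M j p q).

(** * Minors of the reduced matrix *)

(** Reading a minor as a selection of rows makes it compatible with the two ways
    of splitting the rows of the reduced matrix, as u + (v + (j + 1)) in its
    construction and as (u + v) + (j + 1) for its minors. *)
Definition minor_row (u j : nat) (i : 'I_j.+1) (r : 'I_(u + 1)) :
    'I_(u + j.+1) :=
  if split r is inl r' then lshift j.+1 r' else rshift u i.

Lemma minor_rowE (u j : nat) (i : 'I_j.+1) (r : 'I_(u + 1)) :
  minor_row i r = (if (r < u)%N then r : nat else u + i)%N :> nat.
Proof.
by rewrite /minor_row; case: splitP => r' //= ->.
Qed.

Lemma minor_mxE (T : Type) (u j : nat) (M : 'M[T]_(u + j.+1, u + 1)) i r s :
  minor_mx M i r s = M (minor_row i r) s.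
Proof.
by rewrite /minor_mx mxE /minor_row; case: (split r) => r'; rewrite !mxE.
Qed.

(** Every minor keeps all rows of (U A), so it is again a block matrix with the
    corner U, and its lower blocks are the same selection of rows of B and D. *)
Lemma det_minor_block_mx (R : comNzRingType) (u v j : nat)
    (U : 'M[R]_u) (A : 'M_(u, v + 1)) (B : 'M_(v + j.+1, u))
    (D : 'M_(v + j.+1, v + 1)) (i : 'I_j.+1) :
  \det (minor_mx (castmx (addnA _ _ _, addnA _ _ _) (block_mx U A B D)) i) =
  \det (block_mx U A (rowsub (minor_row i) B) (minor_mx D i)).
Proof.
set X := block_mx U A (rowsub _ _) _.
have -> : \det X = \det (castmx (addnA u v 1, addnA u v 1)%N X).
  by case: _ / (addnA u v 1)%N.
congr (\det _); apply/matrixP=> r s; rewrite minor_mxE !castmxE /=.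
move: (cast_ord _ s) => {}s.
set r0 := cast_ord _ (minor_row i r); set r1 := cast_ord _ r.
have r0E : r0 = (if (r1 < u + v)%N then r1 : nat else u + v + i)%N :> nat.
  by rewrite /= minor_rowE.
case: (splitP r1) => r1' Er1.
  have -> : r0 = lshift _ r1'.
    by apply/ord_inj; rewrite r0E Er1 /= ltn_addr.
  have -> : r1 = lshift _ r1' by apply/ord_inj.
  by rewrite !col_mxEu.
have -> : r0 = rshift _ (minor_row i r1').
  apply/ord_inj; rewrite r0E Er1 /= ltn_add2l minor_rowE.
  by case: ifP; rewrite ?addnA.
have -> : r1 = rshift _ r1' by apply/ord_inj.
rewrite !col_mxEd !mxE; case: (split s) => s';
  by rewrite ?minor_mxE ?mxE.
Qed.

(** The choice of h_{p,q} enters only here: with x = (b_{p,1} - b_{p,q}) U^-1,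
    the term b_{p,1} U^-1 v cancels from the Schur complement. *)
Lemma subres_poly_reduced_step (K : fieldType) (u d : nat)
    (M : 'M[K]_(u + d.+1, u + 1)) (j : nat) :
  Umx M \in unitmx ->
  subres_poly (reduced_step M j) = \det (Umx M) *: subres_poly (schur_mx M j).
Proof.
move=> Uu; apply/polyP=> tau; rewrite coefZ !coef_poly.
case: ifP => _; last by rewrite mulr0.
rewrite det_minor_block_mx det_schur //; congr (_ * \det _).
set i := inord _; apply/matrixP=> r s.
rewrite [LHS]mxE [X in _ + X]mxE !minor_mxE.
set p := minor_row i r; set B := rowsub _ _.
have -> : (B *m invmx (Umx M) *m \matrix_(k, q) vcol M k 0) r s =
    (bvec M j p 0 *m invmx (Umx M) *m vcol M) 0 0.
  rewrite !mxE; apply: eq_bigr => k _; rewrite !mxE; congr (_ * _).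
  by apply: eq_bigr => k' _; rewrite !mxE.
have schurE q : schur_form M (bg_row M j p q) =
    gval M j p q - (bvec M j p q *m invmx (Umx M) *m vcol M) 0 0.
  by rewrite /schur_form mxE; congr (_ + _); rewrite mxE.
rewrite [schur_mx M j _ _]mxE schurE [X in X - _]mxE.
(* In the first column the entry is g_{p,1} itself, and its row vector is
   already the shared one. *)
case: eqP => [->|_] //.
rewrite /hval /xvec !mulmxBl mxE [X in _ + (_ + X)]mxE.
by rewrite -addrA addrAC subrr add0r.
Qed.

(** * The subresultants of hat A and its derivative *)

Lemma subres_mx_width (d j : nat) :
  (j < d)%N -> (d + d.-1 - j.*2).-1 = (d.-1 - j).*2.
Proof.
case: d => // d jd /=; rewrite doubleB addSn addnn.
by rewrite subSn //= leq_double.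
Qed.

Lemma Jnum_width (d : nat -> nat) (k j : nat) :
  (j < d k)%N -> Jnum d k.+1 j = (((d k).-1 - j).*2 + 1)%N.
Proof.
by rewrite /Jnum /=; case: (d k) => // e je; rewrite subn1 addn1 -doubleB subSn.
Qed.

(** The identity H = |U| S.  It holds entry by entry because each entry of H is
    a coefficient of hat A or an integer multiple of one, and w |-> |U| f(w)
    sends the row that represents such a coefficient to its value. *)
Lemma subres_poly_schur_mx (K : fieldType) (u d : nat)
    (M : 'M[K]_(u + d.+1, u + 1)) (j : nat) :
  Umx M \in unitmx -> (j < d)%N ->
  subres_poly (subres_mx d d.-1 j (subres_poly M) (subres_poly M)^`()) =
  subres_poly (\det (Umx M) *: schur_mx M j).
Proof.
move=> Uu jd.
have coefM i : (i <= d)%N -> (subres_poly M)`_i =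
    \det (Umx M) * schur_form M (row (inord (d - i)) (dsubmx M)).
  by move=> le_id; rewrite coef_poly ltnS le_id det_minor_mx.
pose E r c := subres_entry d d.-1 j (fun i => (subres_poly M)`_i)
    (fun i => (subres_poly M)^`()`_i) r c.
have -> : \det (Umx M) *: schur_mx M j = \matrix_(r, c) E r c.
  apply/matrixP=> r c; rewrite !mxE /bg_row; apply/esym.
  apply: (@subres_entry_map _ _ (fun w => \det (Umx M) * schur_form M w)).
  - by rewrite schur_form0 mulr0.
  - exact: coefM.
  (* Here j < d excludes d = 0, where the nominal degree of the derivative is
     also 0 and its coefficient of x^0 would need a row of index 1. *)
  - move=> i le_i; rewrite coef_deriv coefM ?schur_formMn ?mulrnAr //.
    by case: (d) jd le_i.
rewrite /subres_mx -/E.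
by case: _ / (subres_mx_width jd).
Qed.

(** * Comparing nested and reduced nested subresultants *)

(** The factor c enters each of the J columns of the next subresultant matrix,
    hence c^J; and |U|^J / |U| is the factor hat B. *)
Lemma nested_subres_step (K : fieldType) (m n : nat) (d : nat -> nat)
    (F G : {poly K}) (k j : nat) (c : K) :
  (0 < k)%N -> (j < d k)%N -> nestedU m n d F G k.+1 \in unitmx ->
  nested_subres m n d F G k (d k) =
    c *: reduced_nested_subres m n d F G k (d k) ->
  nested_subres m n d F G k.+1 j =
    (c ^+ Jnum d k.+1 j * Bhat_at m n d F G k.+1 j)
      *: reduced_nested_subres m n d F G k.+1 j.
Proof.
case: k => // k _ jd.
rewrite /nestedU /nested_subres /reduced_nested_subres /reduced_nested_mx /=.
rewrite /Bhat_at /nestedU /reduced_nested_mx /=.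
move: (reduced_nested_mx_rec _ _ _ _ _ _ _) => M Uu ->.
rewrite derivZ subres_mxZ subres_polyZ subres_poly_schur_mx // subres_polyZ.
rewrite subres_poly_reduced_step // !scalerA -mulrA.
rewrite (subres_mx_width jd) (Jnum_width jd) addn1 /=.
by rewrite [in LHS](exprSr (\det _)).
Qed.

Lemma nested_subres_reduced (K : fieldType) (m n t : nat) (d : nat -> nat)
    (F G : {poly K}) :
  (forall k, (2 <= k <= t)%N -> (d k < d k.-1)%N) ->
  (forall k, (2 <= k <= t)%N -> nestedU m n d F G k \in unitmx) ->
  forall k, (1 <= k <= t)%N ->
  nested_subres m n d F G k (d k) =
    (Rhat m n d F G k * Bhat m n d F G k)
      *: reduced_nested_subres m n d F G k (d k).
Proof.
move=> d_decr Uu; elim=> // k IH /andP[_ lekt].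
case: (posnP k) => [->|k_gt0]; first by rewrite /= !mul1r scale1r.
have k1t : (2 <= k.+1 <= t)%N by rewrite ltnS k_gt0.
have IHk := IH (introT andP (conj k_gt0 (ltnW lekt))).
rewrite (nested_subres_step k_gt0 (d_decr _ k1t) (Uu _ k1t) IHk).
(* From k + 1 = 3 on this is the recursion of Rhat.  At k + 1 = 2 the previous
   factor is 1, whose power is 1 = Rhat 2. *)
congr (_ *: _); case: k k_gt0 {IH IHk lekt k1t} => [|[|k]] // _.
by rewrite /Rhat /Bhat /= !mul1r expr1n mul1r.
Qed.

(** The k-th sequence starts with the last member of the previous one, followed
    by its derivative, which is already of smaller degree, in any
    characteristic. *)
Lemma last_degree_decreasing (R : idomainType) (F G : {poly R}) (m t : nat)
    (l : nat -> nat) (P : nat -> nat -> {poly R}) :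
  is_recursive_prs F G t l P ->
  forall k, (2 <= k <= t)%N ->
  (last_degree m l P k < last_degree m l P k.-1)%N.
Proof.
case=> t_gt0 _ _ linkP prsP [|[|k]] // /andP[_ lekt].
have [P1 P2] := linkP k.+2 lekt.
have [[l_ge2 _ _ P_neq0 P_step] _] := prsP k.+2 lekt.
rewrite /last_degree /= -P1.
have P1_neq0 : P k.+2 1%N != 0 by apply/P_neq0/ltnW.
have le_size i : (2 <= i <= l k.+2)%N ->
    (size (P k.+2 i) <= size (P k.+2 2%N))%N.
  elim: i => // i IHi /andP[i_ge1 lt_il].
  have [->|i_neq1] := eqVneq i 1%N; first by [].
  have i_ge2 : (2 <= i)%N by case: i i_ge1 i_neq1 {IHi lt_il} => [|[|i]].
  have [_] := P_step i.+1 (introT andP (conj i_ge2 lt_il)).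
  rewrite subn1 => /ltnW /leq_trans; apply; apply: IHi; by rewrite i_ge2 ltnW.
have lt21 : (size (P k.+2 2%N) < size (P k.+2 1%N))%N.
  by rewrite P2 /= -P1 lt_size_deriv.
have := leq_ltn_trans (le_size _ (introT andP (conj l_ge2 (leqnn _)))) lt21.
have : (0 < size (P k.+2 (l k.+2)))%N.
  by rewrite size_poly_gt0; apply: P_neq0; rewrite leqnn ltnW.
by case: (size _) (size _) => [|a] [|b].
Qed.

Theorem theorem2 (R : idomainType) (F G : {poly R}) (m n t : nat)
    (l : nat -> nat) (P : nat -> nat -> {poly R}) :
  size F = m.+1 -> size G = n.+1 -> (0 < n)%N -> (n < m)%N ->
  is_complete_recursive_prs F G t l P ->
  let d := last_degree m l P in
  let FK : {poly {fraction R}} := map_poly (@FracField.tofrac R) F in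
  let GK : {poly {fraction R}} := map_poly (@FracField.tofrac R) G in
  (forall k : nat, (2 <= k <= t)%N -> nestedU m n d FK GK k \in unitmx) ->
  forall k j : nat, (2 <= k <= t)%N -> (j + 2 <= d k.-1)%N ->
  map_poly (@FracField.tofrac R) (nested_subres m n d F G k j) =
    ((Rhat m n d FK GK k.-1 * Bhat m n d FK GK k.-1) ^+ Jnum d k j
       * Bhat_at m n d FK GK k j)
      *: reduced_nested_subres m n d FK GK k j.
Proof.
move=> _ _ _ _ [recP _] d FK GK Uu [|[|k]] // j k_bounds lejd.
rewrite map_nested_subres -/FK -/GK.
apply: nested_subres_step => //; last 2 first.
- exact: Uu.
- apply: (nested_subres_reduced _ Uu); first exact: last_degree_decreasing recP.
  by case/andP: k_bounds => _ /ltnW.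
by apply: leq_trans lejd; rewrite addn2.
Qed.
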